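(* Let $V$ be an $n$-dimensional right $\mathbb{H}$-vector space equipped with a positive definite Hermitian form, and let $W$ be a finite group of unitary transformations of $V$ such that $V$ is irreducible as an $\mathbb{H}$-linear representation of $W$. Let $R=\{r\in W \mid \mathrm{codim}_{\mathbb{H}}(\mathrm{fix}(r))=1\}$ be the set of reflections in $W$ (it is not required that $R$ generate $W$, or that $R$ be non-empty), let $\mathcal{A}=\{\mathrm{fix}(r)\mid r\in R\}$, and put $N=|R|$ and $N^*=|\mathcal{A}|$. Then the numbers $$g=\frac{2N}{n},\qquad h=\frac{N+N^*}{n},\qquad k=\frac{2N^*}{n}$$ are all integers.
   Context: $\mathbb{H}$ denotes the quaternions. A Hermitian form $(\cdot,\cdot):V\times V\to\mathbb{H}$ on a right $\mathbb{H}$-vector space is biadditive with $(v\lambda,w\mu)=\overline{\lambda}(v,w)\mu$ and $(w,v)=\overline{(v,w)}$ for $v,w\in V$, $\lambda,\mu\in\mathbb{H}$. Unitary transformations are the $\mathbb{H}$-linear automorphisms of $V$ preserving the form. For $r\in W$, $\mathrm{fix}(r)=\{v\in V\mid r(v)=v\}$. *)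

(* Defs.v *)
From HB Require Import structures.
From mathcomp Require Import all_boot all_order all_algebra.
From mathcomp Require Import finmap ring lra.
From mathcomp Require Import boolp classical_sets reals.

Set Implicit Arguments.
Unset Strict Implicit.
Unset Printing Implicit Defensive.

Import Order.TTheory GRing.Theory Num.Theory.

Local Open Scope classical_set_scope.
Local Open Scope ring_scope.

(* [Quat a b c d] is the quaternion a + bi + cj + dk. *)
Record quat (R : Type) : Type := Quat { qre : R; qi : R; qj : R; qk : R }.

Section QuatRing.
Variable R : realType.
Implicit Types x y z : quat R.

Definition prod_of_quat x := (qre x, qi x, qj x, qk x).
Definition quat_of_prod (p : R * R * R * R) : quat R :=
  Quat p.1.1.1 p.1.1.2 p.1.2 p.2.

Lemma prod_of_quatK : cancel prod_of_quat quat_of_prod.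
Proof. by case. Qed.

HB.instance Definition _ := Choice.copy (quat R) (can_type prod_of_quatK).

Definition addq x y :=
  Quat (qre x + qre y) (qi x + qi y) (qj x + qj y) (qk x + qk y).
Definition oppq x := Quat (- qre x) (- qi x) (- qj x) (- qk x).
Definition realq (a : R) := Quat a 0 0 0.
(* i^2 = j^2 = k^2 = ijk = -1 *)
Definition mulq x y := Quat
  (qre x * qre y - qi x * qi y - qj x * qj y - qk x * qk y)
  (qre x * qi y + qi x * qre y + qj x * qk y - qk x * qj y)
  (qre x * qj y - qi x * qk y + qj x * qre y + qk x * qi y)
  (qre x * qk y + qi x * qj y - qj x * qi y + qk x * qre y).

Definition conjq x := Quat (qre x) (- qi x) (- qj x) (- qk x).

Lemma addqA : associative addq.
Proof. by move=> x y z; rewrite /addq /= !addrA. Qed.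
Lemma addqC : commutative addq.
Proof. by move=> x y; congr Quat; rewrite /= addrC. Qed.
Lemma add0q : left_id (realq 0) addq.
Proof. by case=> a b c d; rewrite /addq /= !add0r. Qed.
Lemma addNq : left_inverse (realq 0) oppq addq.
Proof. by case=> a b c d; rewrite /addq /= !addNr. Qed.

HB.instance Definition _ :=
  GRing.isZmodule.Build (quat R) addqA addqC add0q addNq.

Lemma mulqA : associative mulq.
Proof. by move=> x y z; congr Quat => /=; ring. Qed.
Lemma mul1q : left_id (realq 1) mulq.
Proof. by case=> a b c d; congr Quat => /=; ring. Qed.
Lemma mulq1 : right_id (realq 1) mulq.
Proof. by case=> a b c d; congr Quat => /=; ring. Qed.
Lemma mulqDl : left_distributive mulq +%R.
Proof. by move=> x y z; congr Quat => /=; ring. Qed.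
Lemma mulqDr : right_distributive mulq +%R.
Proof. by move=> x y z; congr Quat => /=; ring. Qed.
Lemma oneq_neq0 : realq 1 != 0.
Proof. by apply/eqP => -[]; apply/eqP; exact: oner_neq0. Qed.

HB.instance Definition _ := GRing.Zmodule_isNzRing.Build (quat R)
  mulqA mul1q mulq1 mulqDl mulqDr oneq_neq0.

Definition normsq x : R := qre x ^+ 2 + qi x ^+ 2 + qj x ^+ 2 + qk x ^+ 2.
Definition invq x := realq (normsq x)^-1 * conjq x.

Lemma normsq_neq0 x : x != 0 -> normsq x != 0.
Proof.
apply: contraNneq => /eqP; case: x => a b c d; rewrite /normsq /=.
rewrite !paddr_eq0 ?addr_ge0 ?sqr_ge0 // !sqrf_eq0.
by case/andP => /andP[/andP[/eqP-> /eqP->] /eqP->] /eqP->.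
Qed.

Lemma mulVq : {in [pred x | x != 0], left_inverse 1 invq *%R}.
Proof.
move=> x /normsq_neq0; case: x => a b c d nx; rewrite /normsq /= in nx.
by congr Quat; rewrite /= /normsq /=; field.
Qed.

Lemma mulqV : {in [pred x | x != 0], right_inverse 1 invq *%R}.
Proof.
move=> x /normsq_neq0; case: x => a b c d nx; rewrite /normsq /= in nx.
by congr Quat; rewrite /= /normsq /=; field.
Qed.

Lemma unitqP x y : y * x = 1 /\ x * y = 1 -> x != 0.
Proof.
by case=> h _; apply: contra_eq_neq h => ->; rewrite mulr0 eq_sym oner_neq0.
Qed.

Lemma invq_out : {in [predC [pred x | x != 0]], invq =1 id}.
Proof. by move=> x; rewrite !inE negbK => /eqP ->; congr Quat => /=; ring. Qed.

HB.instance Definition _ := GRing.NzRing_hasMulInverse.Build (quat R)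
  mulVq mulqV unitqP invq_out.

End QuatRing.

(* Right vector spaces over the quaternions are modules over the converse ring
   (quat R)^c.  Products of scalars below are always taken in quat R, never in
   (quat R)^c, so that v (l m) = (v l) m. *)
Definition rscale (R : realType) (V : lmodType (quat R)^c)
  (v : V) (l : quat R) : V := (l : (quat R)^c) *: v.

Lemma rscaleA (R : realType) (V : lmodType (quat R)^c) (v : V) (l m : quat R) :
  rscale v (l * m) = rscale (rscale v l) m.
Proof. by rewrite /rscale scalerA. Qed.

Section Definitions.
Variables (R : realType) (V : vectType (quat R)^c).

Definition hermitian_form (phi : V -> V -> quat R) : Prop :=
  [/\ forall v v' w, phi (v + v') w = phi v w + phi v' w,
      forall v w w', phi v (w + w') = phi v w + phi v w',
      forall v w (l m : quat R),
        phi (rscale v l) (rscale w m) = conjq l * phi v w * m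
    & forall v w, phi w v = conjq (phi v w)].

Definition positive_definite (phi : V -> V -> quat R) : Prop :=
  forall v, v != 0 -> exists2 a : R, 0 < a & phi v v = realq a.

Definition unitary (phi : V -> V -> quat R) (f : V -> V) : Prop :=
  [/\ linear f, bijective f & forall v w, phi (f v) (f w) = phi v w].

Definition transformation_group (W : {fset (V -> V)}) : Prop :=
  [/\ id \in W,
      forall f g, f \in W -> g \in W -> f \o g \in W
    & forall f, f \in W -> exists2 g, g \in W & cancel f g /\ cancel g f].

Definition irreducible_action (W : {fset (V -> V)}) : Prop :=
  (exists v : V, v != 0) /\
  forall U : set V, submod_closed (mem U) ->
    (forall f u, f \in W -> U u -> U (f u)) ->
    U = [set 0] \/ U = [set: V].

Definition has_dim (U : set V) (d : nat) : Prop :=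
  exists b : 'I_d -> V,
    (forall c : 'I_d -> quat R,
       \sum_(i < d) rscale (b i) (c i) = 0 -> forall i, c i = 0) /\
    U = [set \sum_(i < d) rscale (b i) (c i) | c in [set: 'I_d -> quat R]].

Definition has_codim (U : set V) (c : nat) : Prop :=
  exists2 d, has_dim U d & (d + c)%N = dim V.

Definition fix_set (r : V -> V) : set V := [set v | r v = v].

Definition reflections (W : {fset (V -> V)}) : {fset (V -> V)} :=
  [fset r in W | `[< has_codim (fix_set r) 1 >]]%fset.

Definition hyperplanes (W : {fset (V -> V)}) : {fset (set V)} :=
  [fset fix_set r | r in reflections W]%fset.

End Definitions.

(* Main.v *)
(* Summing orthogonal projections onto the normals [e_H] of the reflecting
   hyperplanes commutes with [W], so by Schur's lemma it is a scalar, which the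
   trace shows to be [N*/n]; likewise the sum of [1 - r] over the reflections
   is the scalar [(N* + N)/n].  To see integrality, let [psi] be the invariant
   complex alternating form underlying the Hermitian form, and [Psi] the
   Z-module spanned by its values on the finite orbit [W {u, u j}].  The sum of
   [1 - r] sends [Psi] to itself, so [h] is a rational algebraic integer.

   For [k], choose for each [H] an element [s] of prime order [p] fixing [H].
   The form [beta (v, w) = psi (P_H v, w)] has rank 2, and [1 - s] acts on the
   normal line with determinant [2 - 2 Re zeta]; so the 2x2 minor of
   [psi ((1 - s) v, w)] is [(2 - 2 Re zeta) beta (v, w)^2].  Summing over the
   powers of [s] yields [2 p beta^2] in [Psi^2].  Hence for [P] the product of
   the odd primes that occur, [2 sqrt(P) beta] is a square root of an element
   of [Psi^2], so is integral over [Psi] in the sense of Rees algebras, and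
   [2 sqrt(P) N*/n] is an algebraic integer.  Thus [P k^2] is an integer, and
   so is [k] since [P] is squarefree.  Finally [g = 2 h - k]. *)
Require Import Defs.
From mathcomp Require Import all_boot all_order all_algebra.
From mathcomp Require Import finmap boolp classical_sets reals.
From mathcomp Require Import all_field ring complex.

Set Implicit Arguments.
Unset Strict Implicit.
Unset Printing Implicit Defensive.

Import Order.TTheory GRing.Theory Num.Theory.

Local Open Scope ring_scope.

(** * Integral elements *)

Section IntegerSpan.
Variable K : fieldType.
Implicit Types (s t : seq K) (x y : K).

(** Explicit integer coefficients let multiplication maps be read off as integer matrices. *)
Definition zspan s x := exists a : 'I_(size s) -> int, x = \sum_(i < size s) s`_i *~ a i.

Lemma zspan0 s : zspan s 0.
Proof. by exists (fun=> 0); rewrite big1 // => i _; rewrite mulr0z. Qed.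

Lemma zspanD s x y : zspan s x -> zspan s y -> zspan s (x + y).
Proof.
move=> [a ->] [b ->]; exists (fun i => a i + b i).
by rewrite -big_split; apply: eq_bigr => i _; rewrite mulrzDr.
Qed.

Lemma zspanMz s x (m : int) : zspan s x -> zspan s (x *~ m).
Proof.
move=> [a ->]; exists (fun i => a i * m).
by rewrite mulrz_suml; apply: eq_bigr => i _; rewrite mulrzA.
Qed.

Lemma zspanMn s x m : zspan s x -> zspan s (x *+ m).
Proof. exact: (@zspanMz s x m). Qed.

Lemma zspanB s x y : zspan s x -> zspan s y -> zspan s (x - y).
Proof. by move=> sx /(@zspanMz _ _ (-1)); rewrite mulrN1z; apply: zspanD. Qed.

Lemma zspan_sum s (I : Type) (r : seq I) (P : pred I) (F : I -> K) :
  (forall i, P i -> zspan s (F i)) -> zspan s (\sum_(i <- r | P i) F i).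
Proof. by move=> h; apply: big_ind => //; [exact: zspan0 | exact: zspanD]. Qed.

Lemma mem_zspan s x : x \in s -> zspan s x.
Proof.
move=> sx; have ltx : (index x s < size s)%N by rewrite index_mem.
exists (fun i => (i == Ordinal ltx)%:Z); rewrite (bigD1 (Ordinal ltx)) //= eqxx.
rewrite mulr1z nth_index // big1 ?addr0 // => i /negPf ->.
by rewrite mulr0z.
Qed.

Lemma zspan_mull s t x y :
  {in s, forall z, zspan t (x * z)} -> zspan s y -> zspan t (x * y).
Proof.
move=> st [a ->]; rewrite mulr_sumr; apply: zspan_sum => i _.
by rewrite mulrzAr; apply/zspanMz/st/mem_nth.
Qed.

Definition prods s t := [seq x * y | x <- s, y <- t].

Lemma zspan_prods s t x y : zspan s x -> zspan t y -> zspan (prods s t) (x * y).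
Proof.
move=> sx ty; apply: zspan_mull ty => z tz; rewrite mulrC.
by apply: zspan_mull sx => u su; apply: mem_zspan; rewrite mulrC allpairs_f.
Qed.

(** The determinant trick: [c] acts on the generators through an integer matrix having the nonzero
    vector of generators as eigenvector, so it is a root of a monic integer characteristic
    polynomial. *)
Lemma zspan_stable_integral s c :
  (exists2 x, x \in s & x != 0) -> {in s, forall x, zspan s (c * x)} ->
  integralOver (intr : int -> K) c.
Proof.
move=> [x0 sx0 nx0] st.
have /fin_all_exists [A hA] (i : 'I_(size s)) :
    exists a : 'I_(size s) -> int, c * s`_i = \sum_(j < size s) s`_j *~ a j.
  by apply: st; apply: mem_nth.
(* Transposed because [eigenvalue] refers to row vectors. *)
pose M : 'M[int]_(size s) := \matrix_(i, j) A j i.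
exists (char_poly M); first exact: char_poly_monic.
rewrite map_char_poly -eigenvalue_root_char.
apply/eigenvalueP; exists (\row_(i < size s) s`_i).
  apply/rowP => i; rewrite !mxE hA; apply: eq_bigr => j _.
  by rewrite !mxE mulrzr.
have lt0 : (index x0 s < size s)%N by rewrite index_mem.
apply: contra_neq nx0 => /rowP /(_ (Ordinal lt0)).
by rewrite !mxE /= nth_index.
Qed.

Fixpoint adjoin_roots s t : seq K :=
  if t is x :: t' then prods (x :: s) (adjoin_roots s t') else [:: 1].

(* The module [M = adjoin_roots s t], the product of the modules
   [Z x + Psi] for [x] in [t], satisfies [t M <= Psi M]. *)
Lemma adjoin_roots_stable s t :
  {in t, forall x, zspan (prods s s) (x ^+ 2)} ->
  {in t & adjoin_roots s t, forall x y,
    zspan (prods s (adjoin_roots s t)) (x * y)}.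
Proof.
elim: t => // z t IH tt x y xt /= yM.
have zt : zspan (prods s s) (z ^+ 2) by apply: tt; rewrite mem_head.
have {}IH : {in t & adjoin_roots s t, forall x y,
    zspan (prods s (adjoin_roots s t)) (x * y)}.
  by apply: IH => w wt; apply: tt; rewrite inE wt orbT.
case/allpairsP: yM => [[u v] /= [us vM ->]].
move: xt; rewrite inE => /predU1P[->|xt].
  move: us; rewrite inE => /predU1P[->|us].
    (* Product [z * z * v]: expand [z ^+ 2] in products [a * b] from [s]; then [a] stays in [Psi]
       and [b * v] lies in [M]. *)
    rewrite mulrA -expr2 mulrC; apply: zspan_mull zt => w /allpairsP[[a b] /= [aS bS ->]].
    rewrite mulrCA; apply: zspan_prods; first exact: mem_zspan.
    by apply: mem_zspan; rewrite mulrC allpairs_f // inE bS orbT.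
  rewrite mulrCA; apply: zspan_prods; first exact: mem_zspan.
  by apply: mem_zspan; rewrite allpairs_f // mem_head.
rewrite mulrCA; apply: zspan_mull (IH _ _ xt vM) => w /allpairsP[[a b] /= [aS bM ->]].
rewrite mulrCA; apply: zspan_prods; apply: mem_zspan => //.
by rewrite allpairs_f.
Qed.

(** With [Psi] and [M] the spans of [s] and [adjoin_roots s t], [c] sends [Psi M] into [t M], which
    lies in [Psi M]; the determinant trick applies to [Psi M]. *)
Lemma integral_sum_roots s t c :
    (exists2 x, x \in s & x != 0) ->
    {in t, forall x, zspan (prods s s) (x ^+ 2)} ->
    {in s, forall x, zspan t (c * x)} ->
  integralOver (intr : int -> K) c.
Proof.
move=> [x0 sx0 nx0] tt ct.
apply: (@zspan_stable_integral (prods s (adjoin_roots s t))).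
  (* [M] contains a power of [x0], hence a nonzero element. *)
  have [y yM ny] : exists2 y, y \in adjoin_roots s t & y != 0.
    elim: t {tt ct} => [|z t [y yM ny]] /=.
      by exists 1; rewrite ?mem_head ?oner_neq0.
    by exists (x0 * y); rewrite ?mulf_neq0 // allpairs_f // inE sx0 orbT.
  by exists (x0 * y); rewrite ?mulf_neq0 // allpairs_f.
move=> _ /allpairsP[[x y] /= [xs yM ->]]; rewrite mulrA mulrC.
apply: zspan_mull (ct _ xs) => z zt; rewrite mulrC.
exact: adjoin_roots_stable.
Qed.

End IntegerSpan.

(** * Integrality criteria for rational numbers *)

(** The monic integer relation descends along the embedding of [rat] in [K] and is then moved to
    [algC], where rational algebraic integers are integers. *)
Lemma integral_ratr_int (K : numFieldType) (q : rat) :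
  integralOver (intr : int -> K) (ratr q) -> q \is a Num.int.
Proof.
case=> p mp /rootP rp.
have rq : root (map_poly intr p : {poly rat}) q.
  apply/rootP/(fmorph_inj (ratr : rat -> K)); rewrite rmorph0 -horner_map /=.
  by rewrite -map_poly_comp (eq_map_poly (ratr_int K)).
have Aq : (ratr q : algC) \in Aint.
  apply: (@root_monic_Aint (map_poly intr p)).
  - have /(rmorph_root (ratr : rat -> algC)) := rq.
    by rewrite -map_poly_comp (eq_map_poly (ratr_int algC)).
  - exact: monic_map.
  - by apply/polyOverP => i; rewrite coef_map rpred_int.
by rewrite -Cint_rat; apply: Cint_rat_Aint Aq; apply: Crat_rat.
Qed.

(** In lowest terms the squared denominator divides [P], so a prime factor of the denominator would
    divide [P] twice. *)
Lemma int_of_squarefree_mul_sqr (P : nat) (q : rat) :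
  (0 < P)%N -> (forall p, prime p -> (logn p P <= 1)%N) ->
  P%:R * q ^+ 2 \is a Num.int -> q \is a Num.int.
Proof.
move=> P0 sqP /intrP[m hm].
have dvd : (denq q ^+ 2 %| P%:Z * numq q ^+ 2)%Z.
  apply/dvdzP; exists m; apply/(intr_inj (R := rat)).
  have hq : q * (denq q)%:~R = (numq q)%:~R.
    by rewrite -{1}[q]divq_num_den mulfVK // intr_eq0 denq_neq0.
  by rewrite !intrM /= -hm -hq; ring.
have {dvd} : (`|denq q| ^ 2 %| P)%N.
  have cop : coprime (`|denq q| ^ 2) (`|numq q| ^ 2).
    by rewrite coprimeXl // coprimeXr // coprime_sym coprime_num_den.
  by rewrite -(Gauss_dvdl _ cop); move: dvd; rewrite dvdzE abszM !abszX.
move=> dP.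
have d1 : `|denq q|%N = 1%N.
  apply/eqP; apply: contraT => d1.
  have d2 : (1 < `|denq q|)%N by rewrite ltn_neqAle eq_sym d1 absz_gt0 denq_neq0.
  have := sqP _ (pdiv_prime d2); rewrite leqNgt -pfactor_dvdn ?pdiv_prime //.
  by rewrite (dvdn_trans _ dP) // dvdn_exp2r // pdiv_dvd.
apply/intrP; exists (numq q); rewrite -{1}[q]divq_num_den.
suff -> : denq q = 1 by rewrite divr1.
by rewrite -[LHS]gez0_abs ?d1.
Qed.

(** * Quaternions and right vector spaces *)

Section DivisionRingDependence.
Variable D : unitRingType.
Hypothesis D_div : forall x : D, x != 0 -> x \is a GRing.unit.

(** Gaussian elimination by induction on the number of coordinates, with scalars kept on the right
    since [D] need not be commutative. *)
Lemma division_ring_dependent m n (A : 'I_m -> 'I_n -> D) : (n < m)%N ->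
  exists2 c : 'I_m -> D, (exists i, c i != 0) &
    forall j, \sum_(i < m) A i j * c i = 0.
Proof.
elim: n m A => [|n IH] [//|m] A ltnm.
  by exists (fun=> 1) => [|[]//]; exists ord0; apply: oner_neq0.
have [/existsP[i0 Ai0]|/existsPn A0] := boolP [exists i, A i ord0 != 0]; last first.
  have [c c0 Ac] := IH m.+1 (fun i j => A i (lift ord0 j)) (ltnW ltnm).
  exists c => // j; have [j' ->|->] := unliftP ord0 j; first exact: Ac.
  by rewrite big1 // => i _; have /negPn/eqP -> := A0 i; rewrite mul0r.
(* Subtracting the pivot row [i0] times [a k] clears the first entry of row [lift i0 k]. A relation
   among the reduced rows then lifts, with pivot coefficient [- \sum_k a k * c k]. *)
pose a k := (A i0 ord0)^-1 * A (lift i0 k) ord0.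
have [c [k0 ck0] Ac] := IH m (fun k j =>
  A (lift i0 k) (lift ord0 j) - A i0 (lift ord0 j) * a k) ltnm.
pose c' i := if unlift i0 i is Some k then c k else - \sum_k a k * c k.
have c'E k : c' (lift i0 k) = c k by rewrite /c' liftK.
have c'0 : c' i0 = - \sum_k a k * c k by rewrite /c' unlift_none.
exists c'; first by exists (lift i0 k0); rewrite c'E.
move=> j; rewrite (bigD1_ord i0) //= c'0 (eq_bigr _ (fun k _ => congr1 _ (c'E k))).
have [j' ->|->] := unliftP ord0 j; last first.
  rewrite mulrN mulr_sumr (eq_bigr _ (fun k _ => mulrA _ _ _)) /a.
  under eq_bigr do rewrite mulrA mulrV ?mul1r ?D_div //.
  by rewrite addrC subrr.
rewrite -[RHS](Ac j') mulrN mulr_sumr addrC -sumrB.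
by apply: eq_bigr => k _; rewrite mulrBl mulrA.
Qed.

End DivisionRingDependence.

(** * Quaternion identities and the complex [j]-component *)

Section Quaternions.
Variable R : realType.
Implicit Types (x y z : quat R) (a b : R).

Lemma quatD x y : x + y =
  Quat (qre x + qre y) (qi x + qi y) (qj x + qj y) (qk x + qk y).
Proof. by []. Qed.

Lemma quat_unit x : x != 0 -> x \is a GRing.unit.
Proof. by []. Qed.

Lemma realq0 : realq 0 = 0 :> quat R. Proof. by []. Qed.

Lemma realq1 : realq 1 = 1 :> quat R. Proof. by []. Qed.

Lemma realqD : {morph @realq R : a b / a + b}.
Proof. by move=> a b; rewrite quatD /realq /=; congr Quat; ring. Qed.

Lemma realqM : {morph @realq R : a b / a * b}.
Proof. by move=> a b; congr Quat; rewrite /=; ring. Qed.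

Lemma realq_comm a x : realq a * x = x * realq a.
Proof. by congr Quat; rewrite /=; ring. Qed.

Lemma realq_inj : injective (@realq R).
Proof. by move=> a b []. Qed.

Lemma realq_nat n : realq n%:R = n%:R :> quat R.
Proof. by elim: n => // n IH; rewrite -!natr1 realqD IH. Qed.

Lemma conjqM x y : conjq (x * y) = conjq y * conjq x.
Proof. by congr Quat; rewrite /=; ring. Qed.

Lemma conjq_realq a : conjq (realq a) = realq a.
Proof. by congr Quat; rewrite /=; ring. Qed.

Lemma mul_conjq x : conjq x * x = realq (normsq x).
Proof. by congr Quat; rewrite /= /normsq; ring. Qed.

Lemma normsq_one_sub x : normsq (1 - x) = 1 + normsq x - 2 * qre x.
Proof. by rewrite /normsq /=; ring. Qed.

Lemma qreD : {morph @qre R : x y / x + y}. Proof. by []. Qed.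

Lemma qre_mulC x y : qre (x * y) = qre (y * x).
Proof. by rewrite /=; ring. Qed.

Lemma qre_sum (I : Type) (r : seq I) (P : pred I) (F : I -> quat R) :
  qre (\sum_(i <- r | P i) F i) = \sum_(i <- r | P i) qre (F i).
Proof. exact: (big_morph (@qre R) qreD). Qed.

(* Writing a quaternion as [z + w j] with [z], [w] complex, this is [w]. *)
Definition jpart x : R[i] := (qj x +i* qk x)%C.

Lemma jpartD : {morph jpart : x y / x + y}. Proof. by []. Qed.

Lemma jpartN : {morph jpart : x / - x}. Proof. by []. Qed.

Lemma jpart_sum (I : Type) (r : seq I) (P : pred I) (F : I -> quat R) :
  jpart (\sum_(i <- r | P i) F i) = \sum_(i <- r | P i) jpart (F i).
Proof. exact: (big_morph jpart jpartD). Qed.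

Lemma jpart_realqM a x : jpart (realq a * x) = a%:C%C * jpart x.
Proof. by apply/eqP; rewrite eq_complex /=; apply/andP; split; apply/eqP; ring. Qed.

(* [jpart (conjq x * y)] is a nondegenerate alternating form on a complex
   plane, on which left multiplication by [z] has determinant [normsq z]. *)
Lemma jpart_minor x y z :
  jpart (conjq x * conjq z * x) * jpart (conjq y * conjq z * y)
    - jpart (conjq x * conjq z * y) * jpart (conjq y * conjq z * x)
  = (normsq z)%:C%C * jpart (conjq x * y) ^+ 2.
Proof.
case: x y z => [a b c d] [a' b' c' d'] [u v w t].
by rewrite expr2; apply/eqP; rewrite eq_complex /= /normsq /=; apply/andP; split;
  apply/eqP; ring.
Qed.

End Quaternions.

(** * Coordinates and linear dependence in right quaternionic spaces *)

Section RightSpaces.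
Import VectorInternalTheory.
Variables (R : realType) (V : vectType (quat R)^c).
Implicit Types (v w : V) (l m : quat R) (f : V -> V).

Lemma rscaleDl v w l : rscale (v + w) l = rscale v l + rscale w l.
Proof. exact: scalerDr. Qed.

Lemma rscaleDr v l m : rscale v (l + m) = rscale v l + rscale v m.
Proof. exact: scalerDl. Qed.

Lemma rscale0l l : rscale (0 : V) l = 0.
Proof. exact: scaler0. Qed.

Lemma rscale0r v : rscale v 0 = 0.
Proof. exact: scale0r. Qed.

Lemma rscale1 v : rscale v 1 = v.
Proof. exact: scale1r. Qed.

Lemma rscaleNl v l : rscale (- v) l = - rscale v l.
Proof. exact: scalerN. Qed.

Lemma rscaleNr v l : rscale v (- l) = - rscale v l.
Proof. exact: scaleNr. Qed.

Lemma rscale_suml (I : Type) (r : seq I) (P : pred I) (F : I -> V) l :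
  rscale (\sum_(i <- r | P i) F i) l = \sum_(i <- r | P i) rscale (F i) l.
Proof. exact: scaler_sumr. Qed.

Lemma rscale_sumr (I : Type) (r : seq I) (P : pred I) (F : I -> quat R) v :
  rscale v (\sum_(i <- r | P i) F i) = \sum_(i <- r | P i) rscale v (F i).
Proof. exact: scaler_suml. Qed.

Lemma rscale_eq0 v l : (rscale v l == 0) = (v == 0) || (l == 0).
Proof.
have [->|nl] := eqVneq l 0; first by rewrite rscale0r eqxx orbT.
rewrite orbF; apply/eqP/eqP => [h|->]; last exact: rscale0l.
by rewrite -(rscale1 v) -(mulqV nl) rscaleA h rscale0l.
Qed.

Section Linear.
Variable f : V -> V.
Hypothesis lin_f : linear f.

Lemma linD v w : f (v + w) = f v + f w.
Proof. by have := lin_f 1 v w; rewrite !scale1r. Qed.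

Lemma lin0 : f 0 = 0.
Proof. by apply/(addrI (f 0)); rewrite -linD !addr0. Qed.

Lemma linZ v l : f (rscale v l) = rscale (f v) l.
Proof. by have := lin_f l v 0; rewrite lin0 !addr0. Qed.

Lemma linB v w : f (v - w) = f v - f w.
Proof.
by rewrite linD; congr (_ + _); apply/(addrI (f w)); rewrite -linD !subrr lin0.
Qed.

Lemma lin_sum (I : Type) (r : seq I) (P : pred I) (F : I -> V) :
  f (\sum_(i <- r | P i) F i) = \sum_(i <- r | P i) f (F i).
Proof. by apply: (big_morph f); [exact: linD | exact: lin0]. Qed.

End Linear.

Definition coordq (i : 'I_(dim V)) v : quat R := v2r v 0 i.
Definition basisq (i : 'I_(dim V)) : V := r2v (delta_mx 0 i).

Lemma coordqD i : {morph coordq i : v w / v + w}.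
Proof. by move=> v w; rewrite /coordq raddfD mxE. Qed.

Lemma coordq0 i : coordq i 0 = 0.
Proof. by rewrite /coordq raddf0 mxE. Qed.

Lemma coordqZ i v l : coordq i (rscale v l) = coordq i v * l.
Proof. by rewrite /coordq /rscale linearZ mxE. Qed.

Lemma coordq_sum i (I : Type) (r : seq I) (P : pred I) (F : I -> V) :
  coordq i (\sum_(k <- r | P k) F k) = \sum_(k <- r | P k) coordq i (F k).
Proof. exact: (big_morph (coordq i) (coordqD i) (coordq0 i)). Qed.

Lemma coordq_basis i j : coordq i (basisq j) = (i == j)%:R.
Proof. by rewrite /coordq r2vK mxE eqxx. Qed.

Lemma coordq_inj v w : (forall i, coordq i v = coordq i w) -> v = w.
Proof. by move=> h; apply: (can_inj v2rK); apply/rowP => i; apply: h. Qed.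

Lemma basisq_sum v : v = \sum_i rscale (basisq i) (coordq i v).
Proof.
apply: coordq_inj => j; rewrite coordq_sum (bigD1 j) //= coordqZ coordq_basis.
rewrite eqxx mul1r big1 ?addr0 // => i ij.
by rewrite coordqZ coordq_basis eq_sym (negPf ij) mul0r.
Qed.

Lemma rscale_dependent d (m : nat) (b : 'I_d -> V) (v : 'I_m -> V) : (d < m)%N ->
    (forall i, exists a, v i = \sum_j rscale (b j) (a j)) ->
  exists2 c : 'I_m -> quat R,
    (exists i, c i != 0) & \sum_i rscale (v i) (c i) = 0.
Proof.
move=> ltdm /boolp.choice[a va].
have [c c0 ac] := division_ring_dependent (@quat_unit R) (fun i j => a i j) ltdm.
exists c => //; under eq_bigr do rewrite va rscale_suml.
rewrite exchange_big big1 //= => j _; under eq_bigr do rewrite -rscaleA.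
by rewrite -rscale_sumr ac rscale0r.
Qed.

Lemma dim_dependent (m : nat) (v : 'I_m -> V) : (dim V < m)%N ->
  exists2 c : 'I_m -> quat R,
    (exists i, c i != 0) & \sum_i rscale (v i) (c i) = 0.
Proof.
by move=> h; apply: (rscale_dependent (b := basisq)) h _ => i; exists (coordq^~ (v i));
  apply: basisq_sum.
Qed.

Lemma basisq_free (c : 'I_(dim V) -> quat R) :
  \sum_i rscale (basisq i) (c i) = 0 -> forall i, c i = 0.
Proof.
move=> h i; have := congr1 (coordq i) h; rewrite coordq0 coordq_sum (bigD1 i) //=.
rewrite coordqZ coordq_basis eqxx mul1r big1 ?addr0 // => j ij.
by rewrite coordqZ coordq_basis eq_sym (negPf ij) mul0r.
Qed.

(** Together [v0], [v] and a basis of the fixed space have [dim V + 1] members. Applying [1 - f] to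
    a relation among them kills the basis terms and leaves one between [v0 - f v0] and [v - f v]. *)
Lemma codim1_fix f : linear f -> has_codim (fix_set f) 1 ->
  exists v0, f v0 != v0 /\
    forall v, exists l, v - f v = rscale (v0 - f v0) l.
Proof.
move=> lin_f [d [b [bfree fixE]] dV]; rewrite addn1 in dV.
(* Were [f] the identity, the [dim V] basis vectors would lie in the span of [d = dim V - 1]
   vectors. *)
have [[v0 nv0]|nex] := pselect (exists v0, f v0 != v0); last first.
  have [c [i ci] /basisq_free c0] : exists2 c : 'I_(dim V) -> quat R,
      (exists i, c i != 0) & \sum_i rscale (basisq i) (c i) = 0.
    apply: (rscale_dependent (b := b)); first by rewrite -dV.
    move=> i; have : fix_set f (basisq i).
      by apply: contrapT => /eqP nfi; apply: nex; exists (basisq i).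
    by rewrite fixE => -[a _ <-]; exists a.
  by rewrite c0 eqxx in ci.
exists v0; split=> // v.
have bfix i : f (b i) = b i.
  suff : fix_set f (b i) by [].
  rewrite fixE; exists (fun j => (j == i)%:R) => //.
  rewrite (bigD1 i) //= eqxx rscale1 big1 ?addr0 // => j /negPf ->.
  exact: rscale0r.
pose u (i : 'I_d.+2) : V :=
  if unlift ord0 i is Some j then
    if unlift ord0 j is Some k then b k else v else v0.
have [c cn0] := dim_dependent u (eq_leq (congr1 S (esym dV))).
rewrite !big_ord_recl /u !unlift_none !liftK unlift_none.
under eq_bigr do rewrite !liftK.
set c0 := c ord0; set c1 := c (lift ord0 ord0) => sumc.
have cE : rscale (v0 - f v0) c0 + rscale (v - f v) c1 = 0.
  move: (sumc); have := congr1 f sumc; set s := bigop _ _ _.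
  have fs : f s = s.
    by rewrite (lin_sum lin_f); apply: eq_bigr => i _; rewrite (linZ lin_f) bfix.
  rewrite (lin0 lin_f) !(linD lin_f) !(linZ lin_f) fs => h1 h2.
  have -> : 0 = (rscale v0 c0 + (rscale v c1 + s))
     - (rscale (f v0) c0 + (rscale (f v) c1 + s)) by rewrite h1 h2 subrr.
  rewrite !rscaleDl !rscaleNl opprD [RHS]addrACA; congr (_ + _).
  by rewrite opprD [RHS]addrACA subrr addr0.
(* If [c1] vanished, so would [c0], leaving a nontrivial relation among the independent [b]. *)
have nc1 : c1 != 0.
  apply/eqP => c10; move: cE; rewrite c10 rscale0r addr0 => /eqP.
  rewrite rscale_eq0 subr_eq0 eq_sym (negPf nv0) /= => /eqP c00.
  case: cn0 => i; move: sumc; rewrite c00 c10 !rscale0r !add0r => /bfree cb.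
  have [j ->|->] := unliftP ord0 i; last by rewrite -/c0 c00 eqxx.
  have [k ->|->] := unliftP ord0 j; last by rewrite -/c1 c10 eqxx.
  by rewrite cb eqxx.
exists (- c0 / c1); rewrite rscaleA rscaleNr.
move/eqP: cE; rewrite addrC addr_eq0 => /eqP <-.
by rewrite -rscaleA mulqV // rscale1.
Qed.

End RightSpaces.

(** * Hermitian forms and reflections *)

Section HermitianSpace.
Local Open Scope classical_set_scope.
Variables (R : realType) (V : vectType (quat R)^c) (phi : V -> V -> quat R).
Hypotheses (hphi : hermitian_form phi) (phi_pos : positive_definite phi).
Implicit Types (v w e : V) (l m : quat R) (f g : V -> V).

Lemma formDl v v' w : phi (v + v') w = phi v w + phi v' w.
Proof. by case: hphi. Qed.

Lemma formDr v w w' : phi v (w + w') = phi v w + phi v w'.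
Proof. by case: hphi. Qed.

Lemma form_conj v w : phi w v = conjq (phi v w).
Proof. by case: hphi. Qed.

Lemma formZr v w m : phi v (rscale w m) = phi v w * m.
Proof.
case: hphi => _ _ /(_ v w 1 m) + _; rewrite rscale1 => ->.
by rewrite -realq1 conjq_realq realq1 mul1r.
Qed.

Lemma formZl v w l : phi (rscale v l) w = conjq l * phi v w.
Proof. by case: hphi => _ _ /(_ v w l 1) + _; rewrite rscale1 mulr1. Qed.

Lemma form0l w : phi 0 w = 0.
Proof. by apply: (addrI (phi 0 w)); rewrite -formDl !addr0. Qed.

Lemma form0r w : phi w 0 = 0.
Proof. by apply: (addrI (phi w 0)); rewrite -formDr !addr0. Qed.

Lemma formBl v v' w : phi (v - v') w = phi v w - phi v' w.
Proof.
rewrite formDl; congr (_ + _); apply: (addrI (phi v' w)).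
by rewrite -formDl !subrr form0l.
Qed.

Lemma formBr v w w' : phi v (w - w') = phi v w - phi v w'.
Proof.
rewrite formDr; congr (_ + _); apply: (addrI (phi v w')).
by rewrite -formDr !subrr form0r.
Qed.

Lemma form_suml (I : Type) (r : seq I) (P : pred I) (F : I -> V) w :
  phi (\sum_(i <- r | P i) F i) w = \sum_(i <- r | P i) phi (F i) w.
Proof.
by apply: (big_morph (phi^~ w)) => [v v'|]; [exact: formDl | exact: form0l].
Qed.

Lemma form_sumr (I : Type) (r : seq I) (P : pred I) (F : I -> V) w :
  phi w (\sum_(i <- r | P i) F i) = \sum_(i <- r | P i) phi w (F i).
Proof.
by apply: (big_morph (phi w)) => [v v'|]; [exact: formDr | exact: form0r].
Qed.

Lemma form_eq0 v : (phi v v == 0) = (v == 0).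
Proof.
apply/eqP/eqP => [h|->]; last exact: form0l.
apply: contra_eq h => /phi_pos [a a0 ->]; rewrite -realq0.
by apply: contra_neq (lt0r_neq0 a0) => /realq_inj.
Qed.

Lemma normalized_form v : v != 0 ->
  exists2 a : R, a != 0 & phi (rscale v (realq a)) (rscale v (realq a)) = 1.
Proof.
move=> /phi_pos[b b0 hb]; have sb : Num.sqrt b != 0 by rewrite sqrtr_eq0 -ltNge.
exists (Num.sqrt b)^-1; first by rewrite invr_eq0.
rewrite formZl formZr conjq_realq hb -!realqM -realq1; congr realq.
have := sqr_sqrtr (ltW b0); set s := Num.sqrt b in sb *; move=> <-.
by field.
Qed.

(** The identity is included, so the elements of [W] with this property form a subgroup. *)
Definition fixes_perp f e := forall v, phi e v = 0 -> f v = v.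

(** The normal spans the image of [1 - f]. Fixed vectors are orthogonal to it because [f] is an
    isometry; conversely, if [v] is orthogonal to it, then [w = v - f v] is orthogonal to [v], which
    forces [phi w w = 0]. *)
Lemma reflection_axis f : unitary phi f -> has_codim (fix_set f) 1 ->
  exists2 e, phi e e = 1 & fix_set f = [set v | phi e v = 0].
Proof.
move=> [lin_f _ isom_f] /(codim1_fix lin_f)[v0 [nv0 im]].
set u := v0 - f v0 in im.
have nu : u != 0 by rewrite subr_eq0 eq_sym.
have [a na unit_e] := normalized_form nu.
exists (rscale u (realq a)) => //; apply/seteqP; split => v /= fv.
  rewrite formZl /u formBl -{2}fv isom_f subrr mulr0 //.
have uv0 : phi u v = 0.
  move/eqP: fv; rewrite formZl conjq_realq => /eqP /(congr1 (fun x => realq a^-1 * x)).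
  by rewrite mulrA -realqM mulVf // realq1 mul1r mulr0.
have [l hl] := im v; set w := v - f v in hl.
have wv : phi w v = 0 by rewrite hl formZl uv0 mulr0.
have vw : phi v w = 0 by rewrite form_conj wv -realq0 conjq_realq.
have : phi w w = phi w v - phi w (f v) by rewrite -formBr.
have -> : phi w (f v) = - phi v w.
  by rewrite {1}/w formBl isom_f /w formBr opprB.
rewrite wv vw oppr0 subr0 => /eqP; rewrite form_eq0 /w subr_eq0.
by move=> /eqP/esym.
Qed.

(** For a unit vector [e] and a unitary [f] fixing its orthogonal, this is the unit quaternion [z]
    with [f e = e z]. *)
Definition eigval e f := phi e (f e).

(** * Unitary maps fixing the orthogonal of a unit vector *)

Section Axis.
Variable e : V.
Hypothesis unit_e : phi e e = 1.

Lemma perp_component v : phi e (v - rscale e (phi e v)) = 0.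
Proof. by rewrite formBr formZr unit_e mul1r subrr. Qed.

(** The difference [w] of both sides is orthogonal to [e], hence fixed by [f]; so
    [phi w (f e) = phi w e = 0] and [phi w w = 0]. *)
Lemma eigvalE f : unitary phi f -> fixes_perp f e -> f e = rscale e (eigval e f).
Proof.
move=> [lin_f _ isom_f] fe; apply/eqP; rewrite -subr_eq0 -form_eq0; apply/eqP.
set w := _ - _; have ew : phi e w = 0 by apply: perp_component.
have fw := fe _ ew.
rewrite {2}/w formBr formZr -{1}fw isom_f (form_conj e w) ew.
by rewrite -realq0 conjq_realq mul0r subrr.
Qed.

(** Split [v] along [e]; the orthogonal component is killed by [1 - f]. *)
Lemma sub_fixes_perp f v : unitary phi f -> fixes_perp f e ->
  v - f v = rscale e ((1 - eigval e f) * phi e v).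
Proof.
move=> uf fe; have [lin_f _ _] := uf; have := fe _ (perp_component v).
rewrite (linB lin_f) (linZ lin_f) (eigvalE uf fe) -rscaleA => h.
rewrite -[f v](subrK (rscale e (eigval e f * phi e v))) h mulrBl mul1r.
by rewrite rscaleDr rscaleNr !opprD !opprK addrA addrA subrr add0r.
Qed.

Lemma eigval_comp f g : unitary phi f -> unitary phi g ->
  fixes_perp f e -> fixes_perp g e -> eigval e (f \o g) = eigval e f * eigval e g.
Proof.
move=> uf ug fe ge; rewrite /eigval /= (eigvalE ug ge); case: (uf) => lin_f _ _.
by rewrite (linZ lin_f) (eigvalE uf fe) -rscaleA !formZr unit_e !mul1r.
Qed.

Lemma eigval_eq1 f : unitary phi f -> fixes_perp f e -> eigval e f = 1 -> f = id.
Proof.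
move=> uf fe f1; apply/funext => v; have := sub_fixes_perp v uf fe.
by rewrite f1 subrr mul0r rscale0r => /eqP; rewrite subr_eq0 => /eqP.
Qed.

Lemma fix_set_perp f : unitary phi f -> fixes_perp f e -> f <> id ->
  fix_set f = [set v | phi e v = 0].
Proof.
move=> uf fe nf; apply/seteqP; split => v /=; last exact: fe.
move=> fv; have := sub_fixes_perp v uf fe; rewrite fv subrr => /esym/eqP.
rewrite rscale_eq0 => /orP[/eqP e0|].
  by move: unit_e; rewrite e0 form0l => /eqP; rewrite eq_sym oner_eq0.
have n1 : 1 - eigval e f != 0.
  by rewrite subr_eq0 eq_sym; apply/eqP => /(eigval_eq1 uf fe).
move=> /eqP/(congr1 (fun x => (1 - eigval e f)^-1 * x)).
by rewrite mulrA mulVr ?mul1r ?mulr0.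
Qed.

Lemma normsq_eigval f : unitary phi f -> fixes_perp f e -> normsq (eigval e f) = 1.
Proof.
move=> uf fe; case: (uf) => _ _ /(_ e e); rewrite (eigvalE uf fe) formZl formZr.
by rewrite unit_e mul1r mul_conjq -realq1 => /realq_inj.
Qed.

(* [jpart (phi (P v) w)] for the orthogonal projection [P] onto the line of [e]. *)
Definition axis_form v w := jpart (conjq (phi e v) * phi e w).

Lemma jform_sub f v w : unitary phi f -> fixes_perp f e ->
  jpart (phi (v - f v) w)
  = jpart (conjq (phi e v) * conjq (1 - eigval e f) * phi e w).
Proof. by move=> uf fe; rewrite (sub_fixes_perp v uf fe) formZl conjqM. Qed.

(** This is [jpart_minor] at [z = 1 - eigval e f]; the eigenvalue has norm one, which gives the
    factor. *)
Lemma axis_form_minor f v w : unitary phi f -> fixes_perp f e ->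
  jpart (phi (v - f v) v) * jpart (phi (w - f w) w)
    - jpart (phi (v - f v) w) * jpart (phi (w - f w) v)
  = (2 - 2 * qre (eigval e f))%:C%C * axis_form v w ^+ 2.
Proof.
move=> uf fe; rewrite !(jform_sub _ _ uf fe) jpart_minor normsq_one_sub.
by rewrite normsq_eigval.
Qed.

End Axis.

(** * Real traces *)

(** Only the real part is kept: [qre (x * y) = qre (y * x)] restores the cyclicity that quaternionic
    traces lack. *)
Definition trq (f : V -> V) : R := \sum_i qre (coordq i (f (basisq i))).

Lemma trq_sum (I : Type) (r : seq I) (P : pred I) (F : I -> V -> V) :
  trq (fun v => \sum_(k <- r | P k) F k v) = \sum_(k <- r | P k) trq (F k).
Proof.
rewrite /trq exchange_big; apply: eq_bigr => i _.
by rewrite coordq_sum qre_sum.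
Qed.

Lemma trq_scalar a : trq (fun v => rscale v (realq a)) = a *+ dim V.
Proof.
rewrite /trq (eq_bigr (fun=> a)) ?sumr_const ?card_ord // => i _.
by rewrite coordqZ coordq_basis eqxx mul1r.
Qed.

(** Cyclicity moves the coordinates of [e] inside the form, where they reassemble [e] and give
    [phi e e]. *)
Lemma trq_proj e a : phi e e = 1 ->
  trq (fun v => rscale e (realq a * phi e v)) = a.
Proof.
move=> unit_e; rewrite /trq.
under eq_bigr => i _ do rewrite coordqZ qre_mulC -mulrA -formZr.
rewrite -qre_sum -mulr_sumr -form_sumr -basisq_sum unit_e mulr1 //.
Qed.

End HermitianSpace.

(** * Schur's lemma *)

Section TransformationGroup.
Variables (T : choiceType) (W : {fset (T -> T)}).
Hypothesis W1 : id \in W.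
Hypothesis WM : forall f g, f \in W -> g \in W -> f \o g \in W.
Hypothesis WV : forall f, f \in W -> exists2 g, g \in W & cancel f g /\ cancel g f.

Lemma group_inverse : exists inv : (T -> T) -> (T -> T), forall f, f \in W ->
  [/\ inv f \in W, inv f \o f = id & f \o inv f = id].
Proof.
suff : forall f, exists g, f \in W -> [/\ g \in W, g \o f = id & f \o g = id].
  by move=> /boolp.choice[inv invW]; exists inv.
move=> f.
have [fW|nfW] := boolP (f \in W); last by exists id.
have [g gW [fK gK]] := WV fW.
by exists g => _; split=> //; apply/funext.
Qed.

Lemma big_group_reindex (S : Type) (idx : S) (op : Monoid.com_law idx)
    (s t : (T -> T) -> (T -> T)) (P : pred (T -> T)) (F : (T -> T) -> S) :
    {in W, forall g, s g \in W} -> {in W, forall g, t g \in W} ->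
    {in W, cancel s t} -> {in W, cancel t s} ->
  \big[op/idx]_(g <- W | P g) F g = \big[op/idx]_(g <- W | P (s g)) F (s g).
Proof.
move=> sW tW sK tK; rewrite -(big_map s P F); apply/esym/perm_big.
apply: uniq_perm; rewrite ?fset_uniq //.
  by rewrite map_inj_in_uniq ?fset_uniq //; apply: can_in_inj sK.
move=> g; apply/mapP/idP => [[h hW ->]|gW]; first exact: sW.
by exists (t g); [apply: tW | rewrite tK].
Qed.

End TransformationGroup.

Section Schur.
Local Open Scope classical_set_scope.
Variables (R : realType) (V : vectType (quat R)^c).
Variable W : {fset (V -> V)}.
Hypotheses (W_group : transformation_group W).
Hypothesis W_linear : forall f, f \in W -> linear f.
Hypothesis W_irr : irreducible_action W.
Variable x : (V -> V) -> R.

(** The action of an element of the real group algebra. Real quaternions are central, so it commutes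
    with right scalars. *)
Definition group_sum v := \sum_(g <- W) rscale (g v) (realq (x g)).

Lemma group_sumD v w : group_sum (v + w) = group_sum v + group_sum w.
Proof.
rewrite -big_split [LHS]big_seq [RHS]big_seq; apply: eq_bigr => g gW /=.
by rewrite (linD (W_linear gW)) rscaleDl.
Qed.

Lemma group_sumZ v l : group_sum (rscale v l) = rscale (group_sum v) l.
Proof.
rewrite rscale_suml [LHS]big_seq [RHS]big_seq; apply: eq_bigr => g gW.
by rewrite (linZ (W_linear gW)) -!rscaleA realq_comm.
Qed.

Lemma group_sum_sum (I : Type) (r : seq I) (P : pred I) (F : I -> V) :
  group_sum (\sum_(i <- r | P i) F i) = \sum_(i <- r | P i) group_sum (F i).
Proof.
apply: (big_morph group_sum) => [|]; first exact: group_sumD.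
by have := group_sumZ 0 0; rewrite !rscale0r.
Qed.

Hypothesis x_conj : forall f g h, f \in W -> g \in W -> h \in W ->
  f \o h = id -> x (f \o g \o h) = x g.
Hypothesis x_inv : forall f g, f \in W -> g \in W -> f \o g = id -> x g = x f.

Lemma group_sum_comm h v : h \in W -> group_sum (h v) = h (group_sum v).
Proof.
move=> hW; have [W1 WM WV] := W_group.
have [h' h'W [hK h'K]] := WV _ hW.
rewrite /group_sum (lin_sum (W_linear hW)).
rewrite (@big_group_reindex _ W _ _ _ (fun g => h \o g \o h') (fun g => h' \o g \o h)).
- rewrite big_seq [RHS]big_seq; apply: eq_bigr => g gW.
  rewrite /= hK (linZ (W_linear hW)); congr (rscale _ (realq _)).
  by apply: x_conj => //; apply/funext.
- by move=> g gW; apply: (WM _ _ (WM _ _ hW gW) h'W).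
- by move=> g gW; apply: (WM _ _ (WM _ _ h'W gW) hW).
- by move=> g gW; apply/funext => u /=; rewrite !hK.
- by move=> g gW; apply/funext => u /=; rewrite !h'K.
Qed.

(** On the span of the orbit of [v0] the operator is described by a real matrix, symmetric by
    [x_inv]. Its eigenvectors cannot all map to zero in [V], since together they yield [v0]. *)
Lemma group_sum_eigenvector : exists2 v, v != 0 &
  exists a : R, group_sum v = rscale v (realq a).
Proof.
have [[v0 nv0] _] := W_irr; have [W1 WM WV] := W_group.
have [inv invW] := group_inverse WV.
pose n := size W; pose gs (i : 'I_n) := nth id W i.
have gsW i : gs i \in W by apply: mem_nth.
(* The coefficient of [gs k v0] in the image of [gs i v0]; these vectors need not be independent. *)
pose M (i k : 'I_n) := x (gs k \o inv (gs i)).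
have Msym i k : M k i = M i k.
  have [iW iK Ki] := invW _ (gsW i); have [kW kK Kk] := invW _ (gsW k).
  apply: x_inv; [exact: (WM _ _ (gsW k) iW) | exact: (WM _ _ (gsW i) kW) |].
  apply/funext => u /=.
  have /(congr1 (@^~ (inv (gs k) u))) /= -> := iK.
  by have /(congr1 (@^~ u)) := Kk.
have actM i : group_sum (gs i v0) = \sum_k rscale (gs k v0) (realq (M i k)).
  have [iW iK Ki] := invW _ (gsW i).
  rewrite /group_sum (@big_group_reindex _ W _ _ _
    (fun g => g \o inv (gs i)) (fun g => g \o gs i)).
  - rewrite (big_nth id) big_mkord; apply: eq_bigr => k _ /=.
    by have /(congr1 (@^~ v0)) /= -> := iK.
  - by move=> g gW; apply: (WM _ _ gW iW).
  - by move=> g gW; apply: (WM _ _ gW (gsW i)).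
  - by move=> g gW; rewrite -compA iK.
  - by move=> g gW; rewrite -compA Ki.
pose comb (c : 'I_n -> R) := \sum_i rscale (gs i v0) (realq (c i)).
have comb_eigen (c : 'I_n -> R) a : (forall k, \sum_i c i * M i k = a * c k) ->
    group_sum (comb c) = rscale (comb c) (realq a).
  move=> hc; rewrite group_sum_sum rscale_suml.
  under eq_bigr => i _ do rewrite group_sumZ actM rscale_suml.
  rewrite exchange_big /=; apply: eq_bigr => k _.
  under eq_bigr => i _ do rewrite -rscaleA -realqM mulrC.
  rewrite -rscale_sumr -rscaleA -realqM mulrC -hc; congr rscale.
  by apply/esym/(big_morph (@realq R)) => [a1 a2|]; [exact: realqD|].
pose A : 'M[R[i]]_n := \matrix_(i, k) (M i k)%:C%C.
have Aherm : A \is hermsymmx.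
  apply: realsym_hermsym.
    apply/is_hermitianmxP; rewrite expr0 scale1r; apply/matrixP => i k.
    by rewrite !mxE Msym.
  by apply/mxOverP => i k; rewrite mxE complex_real.
pose P := spectralmx A; pose D := spectral_diag A.
have PA : P *m A = diag_mx D *m P.
  have /orthomx_spectralP -> := hermitian_normalmx Aherm.
  by rewrite !mulmxA mulmxV ?spectral_unit // mul1mx.
have Dreal a : exists b : R, D 0 a = b%:C%C.
  have /mxOverP /(_ 0 a) := hermitian_spectral_diag_real Aherm.
  by move=> /complex_realP[b hb]; exists b.
(* Matrix and eigenvalues are real, so the real and imaginary parts of a row of [P] satisfy the
   eigenvalue equation separately. *)
have rowP a : exists b : R,
    (group_sum (comb (fun i => complex.Re (P a i))) =
       rscale (comb (fun i => complex.Re (P a i))) (realq b)) /\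
    (group_sum (comb (fun i => complex.Im (P a i))) =
       rscale (comb (fun i => complex.Im (P a i))) (realq b)).
  have [b Db] := Dreal a; exists b.
  have h k : \sum_i P a i * (M i k)%:C%C = b%:C%C * P a k.
    have := congr1 (fun X : 'M_n => X a k) PA; rewrite mul_diag_mx !mxE Db => <-.
    by apply: eq_bigr => i _; rewrite mxE.
  split; apply: comb_eigen => k.
    have := congr1 (@complex.Re R) (h k); rewrite raddf_sum /=.
    case: (P a k) => p q /=; rewrite mul0r subr0 => <-.
    by apply: eq_bigr => i _; case: (P a i) => p' q' /=; rewrite mulr0 subr0.
  have := congr1 (@complex.Im R) (h k); rewrite raddf_sum /=.
  case: (P a k) => p q /=; rewrite mul0r addr0 => <-.
  by apply: eq_bigr => i _; case: (P a i) => p' q' /=; rewrite mulr0 add0r.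
apply: contrapT => none.
have comb0 c b : group_sum (comb c) = rscale (comb c) (realq b) -> comb c = 0.
  by move=> h; apply: contrapT => /eqP nz; apply: none; exists (comb c) => //; exists b.
have lt1 : (index (id : V -> V) W < n)%N by rewrite index_mem.
pose i1 := Ordinal lt1.
have gs1 : gs i1 = id by rewrite /gs nth_index.
move/eqP: nv0; apply.
(* The identity [invmx P *m P = 1] expands the unit row at [i1], which represents [v0], in the rows
   of [P]. *)
have delta k : complex.Re (\sum_a invmx P i1 a * P a k) = (i1 == k)%:R :> R.
  have := congr1 (fun X : 'M_n => X i1 k) (mulVmx (spectral_unit A)).
  by rewrite !mxE => ->; case: (i1 == k).
have -> : v0 = comb (fun k => (i1 == k)%:R).
  rewrite /comb (bigD1 i1) //= eqxx realq1 rscale1 gs1 big1 ?addr0 // => k.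
  by rewrite eq_sym => /negPf ->; rewrite realq0 rscale0r.
have -> : comb (fun k => (i1 == k)%:R) = \sum_a
    (rscale (comb (fun i => complex.Re (P a i))) (realq (complex.Re (invmx P i1 a)))
     - rscale (comb (fun i => complex.Im (P a i))) (realq (complex.Im (invmx P i1 a)))).
  under eq_bigr => a _ do rewrite !rscale_suml -sumrB.
  rewrite exchange_big; apply: eq_bigr => k _ /=.
  under eq_bigr => a _ do rewrite -!rscaleA -rscaleNr -rscaleDr.
  rewrite -rscale_sumr; congr rscale; rewrite -delta raddf_sum.
  rewrite (big_morph (@realq R) (@realqD R) (realq0 R)); apply: eq_bigr => a _.
  case: (P a k) => p q; case: (invmx P i1 a) => p' q'.
  by congr Quat => /=; ring.
by rewrite big1 // => a _; have [b [/comb0 -> /comb0 ->]] := rowP a;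
  rewrite !rscale0l subrr.
Qed.

(** The eigenspace of a real eigenvalue is closed under right scalars and stable under [W]; being
    nonzero, it is all of [V]. *)
Lemma group_sum_scalar :
  exists a : R, forall v, group_sum v = rscale v (realq a).
Proof.
have [v nv [a va]] := group_sum_eigenvector; exists a => w.
pose U := [set u | group_sum u = rscale u (realq a)].
have [||U0|UT] := (proj2 W_irr) U.
- split=> [|l u u']; rewrite !inE /U /=.
    by have := group_sumZ 0 0; rewrite !rscale0r => ->; rewrite rscale0l.
  move=> hu hu'; rewrite -/(rscale u l) group_sumD group_sumZ hu hu'.
  by rewrite rscaleDl -!rscaleA realq_comm.
- move=> f u fW; rewrite /U /= => hu.
  by rewrite group_sum_comm // hu (linZ (W_linear fW)).
- have : U v by []; rewrite U0 => /= v0.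
  by rewrite v0 eqxx in nv.
- by have : U w by rewrite UT.
Qed.

End Schur.

(** * Reflection groups *)

Lemma logn_prod_primes (s : seq nat) q : prime q -> uniq s -> all prime s ->
  (logn q (\prod_(p <- s) p)%N <= 1)%N.
Proof.
move=> pq us ps; suff -> : logn q (\prod_(p <- s) p)%N = count_mem q s.
  by rewrite count_uniq_mem // leq_b1.
elim: s ps {us} => [|p s IH] /=; first by rewrite big_nil logn1.
case/andP => pp ps; rewrite big_cons lognM ?(prime_gt0 pp) //.
  by rewrite IH // logn_prime // eq_sym.
by rewrite big_seq prodn_cond_gt0 // => r /(allP ps)/prime_gt0.
Qed.

Section ReflectionGroup.
Local Open Scope classical_set_scope.
Variables (R : realType) (V : vectType (quat R)^c) (phi : V -> V -> quat R).
Hypotheses (hphi : hermitian_form phi) (phi_pos : positive_definite phi).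
Variable W : {fset (V -> V)}.
Hypotheses (W_group : transformation_group W).
Hypothesis W_unitary : forall f, f \in W -> unitary phi f.

Let W1 : id \in W. Proof. by case: W_group. Qed.
Let WM f g : f \in W -> g \in W -> f \o g \in W.
Proof. by case: W_group => _ + _; apply. Qed.
Let WV f : f \in W -> exists2 g, g \in W & cancel f g /\ cancel g f.
Proof. by case: W_group => _ _; apply. Qed.
Let W_linear f : f \in W -> linear f. Proof. by move=> /W_unitary[]. Qed.

Lemma reflectionsP r :
  reflect (r \in W /\ has_codim (fix_set r) 1) (r \in reflections W).
Proof. by rewrite !inE; apply: (iffP andP) => -[-> /asboolP]. Qed.

Lemma right_inverse_left f h : f \in W -> f \o h = id -> h \o f = id.
Proof.
move=> fW fh; have [g gW [fK gK]] := WV fW.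
by apply/funext => v /=; apply: (can_inj fK); have /(congr1 (@^~ (f v))) /= -> := fh.
Qed.

Lemma iter_group k f : f \in W -> iter k f \in W.
Proof. by move=> fW; elim: k => [|k IH]; [exact: W1 | exact: (WM fW IH)]. Qed.

Lemma group_finite_order r : r \in W -> exists2 k, (0 < k)%N & iter k r = id.
Proof.
move=> rW; have [r' r'W [rK r'K]] := WV rW.
have : ~~ uniq [seq iter i r | i <- iota 0 (size W).+1].
  apply/negP => u; suff : (size [seq iter i r | i <- iota 0 (size W).+1] <= size W)%N.
    by rewrite size_map size_iota ltnn.
  by apply: (uniq_leq_size u) => _ /mapP[i _ ->]; apply: iter_group.
case/(uniqPn (id : V -> V)) => i [j [ij]]; rewrite size_map size_iota => jW.
have iW := ltn_trans ij jW.
rewrite !(nth_map 0%N) ?size_iota // !nth_iota // !add0n => eij.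
exists (j - i)%N; first by rewrite subn_gt0.
have iterK : cancel (iter i r) (iter i r').
  by elim: {eij ij iW} i => // i IH v; rewrite iterSr /= rK IH.
apply/funext => v; apply: (can_inj iterK).
by rewrite -iterD subnKC ?eij // ltnW.
Qed.

(** The exponent is the order [k] divided by its least prime factor; minimality of [k] keeps this
    power nontrivial. *)
Lemma group_prime_order r : r \in W -> r <> id ->
  exists2 k, iter k r <> id & exists2 p, prime p & iter p (iter k r) = id.
Proof.
move=> rW nr; have [k0 k00 hk0] := group_finite_order rW.
have ex : exists k, (0 < k)%N && (iter k r == id) by exists k0; rewrite k00 hk0 eqxx.
case: (ex_minnP ex) => k /andP[k_gt0 /eqP hk] kmin.
have k1 : (1 < k)%N.
  by rewrite ltn_neqAle k_gt0 andbT; apply/eqP => k1; apply: nr; rewrite -k1 in hk.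
exists (k %/ pdiv k)%N; last first.
  exists (pdiv k); first exact: pdiv_prime.
  by apply/funext => v; rewrite -iterM mulnC divnK ?pdiv_dvd ?hk.
move=> /eqP h; have := kmin (k %/ pdiv k)%N.
rewrite h divn_gt0 ?pdiv_gt0 // dvdn_leq ?pdiv_dvd // => /(_ isT).
by rewrite leqNgt ltn_Pdiv // prime_gt1 // pdiv_prime.
Qed.

Lemma has_codim_conj f g h d : f \in W -> f \o h = id ->
  has_codim (fix_set g) d -> has_codim (fix_set (f \o g \o h)) d.
Proof.
move=> fW fh [d' [b [bfree bfix]] dd]; exists d' => //; exists (f \o b).
have hf := right_inverse_left fW fh.
have fK v : h (f v) = v by have /(congr1 (@^~ v)) := hf.
have hK v : f (h v) = v by have /(congr1 (@^~ v)) := fh.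
have fsum (c : 'I_d' -> quat R) :
    f (\sum_(i < d') rscale (b i) (c i)) = \sum_(i < d') rscale ((f \o b) i) (c i).
  by rewrite (lin_sum (W_linear fW)); apply: eq_bigr => i _; rewrite (linZ (W_linear fW)).
split=> [c|]; first rewrite -fsum.
  by move=> /(congr1 h); rewrite fK -[X in _ = h X](lin0 (W_linear fW)) fK; apply: bfree.
apply/seteqP; split=> v /=.
  move=> /(congr1 h); rewrite fK => hv; have : fix_set g (h v) by [].
  by rewrite bfix => -[c _ hc]; exists c => //; rewrite -fsum hc.
case=> c _ <-; rewrite -fsum /fix_set /= fK; congr (f _).
suff : fix_set g (\sum_(i < d') rscale (b i) (c i)) by [].
by rewrite bfix; exists c.
Qed.

Lemma reflections_conj f g h : f \in W -> g \in W -> h \in W -> f \o h = id ->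
  (f \o g \o h \in reflections W) = (g \in reflections W).
Proof.
move=> fW gW hW fh; apply/reflectionsP/reflectionsP => -[rW cr]; last first.
  by split; [exact: (WM (WM fW gW) hW) | exact: has_codim_conj].
split=> //; have hf := right_inverse_left fW fh.
suff -> : g = h \o (f \o g \o h) \o f by apply: has_codim_conj.
have fK v : h (f v) = v by have /(congr1 (@^~ v)) := hf.
by apply/funext => v /=; rewrite !fK.
Qed.

(** * Pointwise stabilisers of reflecting hyperplanes *)

Definition fixes (H : set V) g := `[< forall v, H v -> g v = v >].
(** The order of the pointwise stabiliser: for a reflecting hyperplane, one more than the number of
    its reflections. *)
Definition mult (H : set V) := (\sum_(g <- W | fixes H g) 1)%N.

Lemma mult_conj f g h : f \in W -> h \in W -> f \o h = id ->
  mult (fix_set (f \o g \o h)) = mult (fix_set g).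
Proof.
move=> fW hW fh; have hf := right_inverse_left fW fh.
have fK v : h (f v) = v by have /(congr1 (@^~ v)) := hf.
have hK v : f (h v) = v by have /(congr1 (@^~ v)) := fh.
rewrite /mult (@big_group_reindex _ W _ _ _
  (fun k => f \o k \o h) (fun k => h \o k \o f)).
- apply: eq_bigl => k; apply/asboolP/asboolP => hk v gv /=.
    have := hk (f v); rewrite /fix_set /= fK => /(_ (congr1 f gv)).
    exact: (can_inj fK).
  have := congr1 h gv; rewrite /= fK => ghv.
  by rewrite hk ?hK.
- by move=> k kW; apply: (WM (WM fW kW) hW).
- by move=> k kW; apply: (WM (WM hW kW) fW).
- by move=> k kW; apply/funext => u /=; rewrite !fK.
- by move=> k kW; apply/funext => u /=; rewrite !hK.
Qed.

Lemma hyperplane_normals : exists nrm : set V -> V,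
  forall H, H \in hyperplanes W ->
    phi (nrm H) (nrm H) = 1 /\ H = [set v | phi (nrm H) v = 0].
Proof.
suff : forall H, exists e, H \in hyperplanes W ->
    phi e e = 1 /\ H = [set v | phi e v = 0] by move=> /boolp.choice[nrm ?]; exists nrm.
move=> H; have [/imfsetP[r /reflectionsP[rW cr] ->]|nH] := boolP (H \in hyperplanes W).
  by have [e e1 er] := reflection_axis hphi phi_pos (W_unitary rW) cr; exists e.
by exists 0.
Qed.

Variable nrm : set V -> V.
Hypothesis nrmP : forall H, H \in hyperplanes W ->
    phi (nrm H) (nrm H) = 1 /\ H = [set v | phi (nrm H) v = 0].

Section Hyperplane.
Variable H : set V.
Hypothesis HA : H \in hyperplanes W.
Let e := nrm H.
Let unit_e : phi e e = 1. Proof. by have [] := nrmP HA. Qed.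

Lemma fixesP g : reflect (fixes_perp phi g e) (fixes H g).
Proof.
have [_ HE] := nrmP HA.
by apply: (iffP (asboolP _)) => h v hv; apply: h; move: hv; rewrite [H]HE.
Qed.

(** A nontrivial element of the stabiliser fixes nothing outside [H], and [H] has codimension one
    because it comes from some reflection. *)
Lemma reflection_fixes g : g \in W ->
  (g \in reflections W) && (fix_set g == H) = (fixes H g) && (g != id).
Proof.
move=> gW; have [_ HE] := nrmP HA; apply/andP/andP => [[gR /eqP gH]|[gH ng]].
  split; first by apply/asboolP => v; rewrite -gH.
  apply/eqP => g1; move: unit_e; have : H e by rewrite -gH g1.
  by rewrite {1}HE /= -/e => -> /eqP; rewrite eq_sym oner_eq0.
have fg : fix_set g = H.
  by rewrite HE; apply: fix_set_perp => //; [exact: W_unitary | exact/fixesP | exact/eqP].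
split; last exact/eqP.
have /imfsetP[r /reflectionsP[rW cr] rH] := HA.
by apply/reflectionsP; split=> //; rewrite fg rH.
Qed.

Lemma exists_reflection : exists r, [/\ r \in W, fixes H r & r != id].
Proof.
have /imfsetP[r rR rH] := HA; have [rW _] := reflectionsP _ rR.
by exists r; have := reflection_fixes rW; rewrite rR rH eqxx => /esym/andP[].
Qed.

Lemma big_fixes (S : Type) (idx : S) (op : Monoid.com_law idx) (F : (V -> V) -> S) :
  \big[op/idx]_(g <- W | fixes H g) F g =
  op (F id) (\big[op/idx]_(g <- reflections W | fix_set g == H) F g).
Proof.
rewrite [LHS]big_fset_condE [in RHS]big_fset_condE.
rewrite (big_fsetD1 (id : V -> V)) /=; last first.
  by rewrite !inE W1; apply/asboolP.
congr (op _ _); apply: eq_fbigl => g; rewrite !inE /=.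
transitivity ((g \in W) && (fixes H g && (g != id))); first by rewrite andbC -andbA.
have [gW|gW] := boolP (g \in W); last by [].
by rewrite -reflection_fixes //= !inE /= gW.
Qed.

(** Left multiplication by a reflection [r] permutes the stabiliser, so the sum [s] satisfies
    [s = z * s], where the eigenvalue [z] of [r] is not 1. *)
Lemma sum_eigval : \sum_(g <- W | fixes H g) eigval phi e g = 0.
Proof.
have [r [rW rH nr]] := exists_reflection.
have [r' r'W [rK r'K]] := WV rW.
set s := \sum_(_ <- _ | _) _.
have hs : s = eigval phi e r * s.
  rewrite {1}/s (@big_group_reindex _ W _ _ _ (fun g => r \o g) (fun g => r' \o g)).
  - rewrite mulr_sumr big_seq_cond [RHS]big_seq_cond.
    have fr g : fixes H (r \o g) = fixes H g.
      apply/fixesP/fixesP => hg v hv; have := hg v hv; rewrite /=.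
        by move/fixesP: rH => /(_ v hv) {2}<- /(can_inj rK).
      by move=> ->; move/fixesP: rH; apply.
    apply: eq_big => [g|g]; first by rewrite fr.
    rewrite fr => /andP[gW gH].
    by apply: eigval_comp => //; [| |exact/fixesP|exact/fixesP]; exact: W_unitary.
  - by move=> g gW; apply: WM.
  - by move=> g gW; apply: WM.
  - by move=> g gW; apply/funext => u /=; rewrite rK.
  - by move=> g gW; apply/funext => u /=; rewrite r'K.
have n1 : 1 - eigval phi e r != 0.
  rewrite subr_eq0 eq_sym; apply: contra_neq nr.
  by apply: eigval_eq1 => //; [exact: W_unitary | exact/fixesP].
have : (1 - eigval phi e r) * s = 0 by rewrite mulrBl mul1r -hs subrr.
move=> /(congr1 (fun x => (1 - eigval phi e r)^-1 * x)).
by rewrite mulrA mulVr ?mul1r ?mulr0.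
Qed.

(** The identity contributes zero, so the sum extends to the whole stabiliser, where the eigenvalues
    cancel. *)
Lemma sum_reflections_fixing v :
  \sum_(g <- reflections W | fix_set g == H) (v - g v)
  = rscale e ((mult H)%:R * phi e v).
Proof.
have := big_fixes +%R (fun g => v - g v); rewrite /= subrr add0r => <-.
rewrite big_seq_cond (eq_bigr (fun g => rscale e ((1 - eigval phi e g) * phi e v))).
  rewrite -big_seq_cond -rscale_sumr -mulr_suml sumrB sum_eigval subr0.
  by rewrite /mult natr_sum.
move=> g /andP[gW gH]; apply: sub_fixes_perp => //; first exact: W_unitary.
exact/fixesP.
Qed.

End Hyperplane.

Lemma multE H : H \in hyperplanes W ->
  mult H = (1 + \sum_(g <- reflections W | fix_set g == H) 1)%N.
Proof. by move=> HA; apply: (big_fixes HA addn (fun=> 1%N)). Qed.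

Lemma sum_mult : (\sum_(H <- hyperplanes W) mult H =
  #|` reflections W| + #|` hyperplanes W|)%N.
Proof.
rewrite big_seq (eq_bigr _ multE) -big_seq big_split /= addnC sum1_size.
by congr addn; rewrite -sum1_size (partition_big_imfset _ (@fix_set R V)).
Qed.

(** The weight serves two cases: [c = 1] gives the sum of [1 - r], and the inverse of [mult] gives
    the sum of the projections onto the normals. *)
Lemma reflection_sumE (c : set V -> R) v :
  \sum_(g <- reflections W) rscale (v - g v) (realq (c (fix_set g))) =
  \sum_(H <- hyperplanes W)
     rscale (nrm H) (realq (c H * (mult H)%:R) * phi (nrm H) v).
Proof.
rewrite (partition_big_imfset _ (@fix_set R V)) [LHS]big_seq [RHS]big_seq.
apply: eq_bigr => H HA.
rewrite (eq_bigr (fun g => rscale (v - g v) (realq (c H)))); last by move=> g /eqP ->.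
rewrite -rscale_suml sum_reflections_fixing // -rscaleA -realq_comm mulrA.
by rewrite realqM realq_nat.
Qed.

(** * Scalars from Schur's lemma and their traces *)

Hypothesis W_irr : irreducible_action W.

Lemma reflection_sum_scalar (c : set V -> R) :
    (forall f g h, f \in W -> h \in W -> f \o h = id ->
       c (fix_set (f \o g \o h)) = c (fix_set g)) ->
  exists a : R,
    (forall v, \sum_(H <- hyperplanes W)
       rscale (nrm H) (realq (c H * (mult H)%:R) * phi (nrm H) v) =
       rscale v (realq a)) /\
    a *+ dim V = \sum_(H <- hyperplanes W) c H * (mult H)%:R.
Proof.
move=> c_conj.
(* Extension by zero turns the weighted sum of reflections into a [group_sum]. *)
pose x g := if g \in reflections W then c (fix_set g) else 0.
have [a ha] : exists a : R, forall v, group_sum W x v = rscale v (realq a).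
  apply: group_sum_scalar => // [f g h fW gW hW fh|f g fW gW fg].
    by rewrite /x reflections_conj // c_conj.
  have gf := right_inverse_left fW fg.
  (* Inverse elements have the same fixed space, hence the same weight. *)
  have fixfg : fix_set g = fix_set f.
    apply/seteqP; rewrite /fix_set; split=> v /= hv.
      by rewrite -[in LHS]hv; have /(congr1 (@^~ v)) := fg.
    by rewrite -[in LHS]hv; have /(congr1 (@^~ v)) := gf.
  rewrite /x fixfg; congr (if _ then _ else _).
  by apply/reflectionsP/reflectionsP => -[_ cr]; split; rewrite // ?fixfg // -fixfg.
(* The reflections sum to the scalar [a], so the maps [1 - r] sum to the total weight minus [a]. *)
pose b := \sum_(g <- reflections W) c (fix_set g) - a.
have hb v : \sum_(H <- hyperplanes W)
    rscale (nrm H) (realq (c H * (mult H)%:R) * phi (nrm H) v) = rscale v (realq b).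
  rewrite -reflection_sumE.
  have -> : rscale v (realq b) =
      \sum_(g <- reflections W) rscale v (realq (c (fix_set g))) - group_sum W x v.
    rewrite ha -rscale_sumr -(big_morph (@realq R) (@realqD R) (realq0 R)).
    rewrite -rscaleNr -rscaleDr /b; congr rscale.
    by congr Quat => /=; ring.
  have -> : group_sum W x v =
      \sum_(g <- reflections W) rscale (g v) (realq (c (fix_set g))).
    rewrite /group_sum -(@big_fset_incl _ _ _ _ (reflections W) W).
    - by rewrite big_seq [RHS]big_seq; apply: eq_bigr => g gR; rewrite /x gR.
    - by apply/fsubsetP => g /reflectionsP[].
    - by move=> g _ gR; rewrite /x (negPf gR) realq0 rscale0r.
  rewrite -sumrB; apply: eq_bigr => g _.
  by rewrite rscaleDl rscaleNl.
exists b; split=> //; rewrite -trq_scalar -(funext hb) trq_sum.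
rewrite [LHS]big_seq [RHS]big_seq; apply: eq_bigr => H /nrmP[e1 _].
exact: trq_proj.
Qed.

Lemma exists_unit_vector : exists u, phi u u = 1.
Proof.
have [[v nv] _] := W_irr; have [a _ h] := normalized_form hphi phi_pos nv.
by exists (rscale v (realq a)).
Qed.

(** * Values on a finite orbit and integrality of the scalars *)

Variable u : V.
Hypothesis unit_u : phi u u = 1.

(** [Quat 0 0 1 0] is [j]. Including [u j] guarantees a nonzero value: [jpart] vanishes on
    [phi u u = 1] but not on [phi u (u j) = j]. *)
Definition orbit_vectors :=
  [seq g (rscale u l) | g <- W, l <- [:: 1; Quat 0 0 1 0]].

Definition orbit_values :=
  [seq jpart (phi v w) | v <- orbit_vectors, w <- orbit_vectors].

Lemma orbit_vectors_stable g v : g \in W -> v \in orbit_vectors ->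
  g v \in orbit_vectors.
Proof.
move=> gW /allpairsP[[f l] /= [fW ll ->]].
by apply/allpairsP; exists (g \o f, l); split=> //; apply: WM.
Qed.

Lemma orbit_values_neq0 : exists2 x, x \in orbit_values & x != 0.
Proof.
exists (jpart (phi u (rscale u (Quat 0 0 1 0)))).
  apply: allpairs_f.
    by apply/allpairsP; exists (id, 1); rewrite ?mem_head /= rscale1.
  by apply/allpairsP; exists (id, Quat 0 0 1 0); rewrite !inE eqxx orbT.
rewrite formZr // unit_u mul1r /jpart /=; apply/eqP => -[]; apply/eqP.
exact: oner_neq0.
Qed.

Lemma zspan_jform v w : v \in orbit_vectors -> w \in orbit_vectors ->
  zspan orbit_values (jpart (phi v w)).
Proof. by move=> vO wO; apply: mem_zspan; apply: allpairs_f. Qed.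

Lemma zspan_jform_sub g v w : g \in W -> v \in orbit_vectors ->
  w \in orbit_vectors -> zspan orbit_values (jpart (phi (v - g v) w)).
Proof.
move=> gW vO wO; rewrite formBl // jpartD jpartN.
by apply: zspanB; apply: zspan_jform => //; apply: orbit_vectors_stable.
Qed.

Lemma jformZ a v w : jpart (phi (rscale v (realq a)) w) = a%:C%C * jpart (phi v w).
Proof. by rewrite formZl // conjq_realq jpart_realqM. Qed.

(** With weight 1, [a] times a value [jpart (phi v w)] is the sum of [jpart (phi (v - r v) w)],
    again in the span because the orbit is stable. *)
Lemma reflection_sum_integral :
  exists2 a : R, integralOver (intr : int -> R[i]) a%:C%C &
    a *+ dim V = (#|` reflections W| + #|` hyperplanes W|)%:R.
Proof.
have [//|a [ha aV]] := @reflection_sum_scalar (fun=> 1).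
exists a.
  apply: zspan_stable_integral orbit_values_neq0 _ => _ /allpairsP[[v w] /= [vO wO ->]].
  rewrite -jformZ -ha -(reflection_sumE (fun=> 1)) form_suml // jpart_sum.
  rewrite big_seq; apply: zspan_sum => g /reflectionsP[gW _].
  by rewrite realq1 rscale1; apply: zspan_jform_sub.
by rewrite aV -sum_mult natr_sum; apply: eq_bigr => H _; rewrite mul1r.
Qed.

(** The factors [2 - 2 Re (z ^+ i)] in the minors add up to [2 p], since the powers of [z] sum to
    zero. The prime order lets a squarefree [P] suffice later. *)
Lemma axis_form_integral H : H \in hyperplanes W -> exists2 p, prime p &
  {in orbit_vectors &, forall v w,
    zspan (prods orbit_values orbit_values) (axis_form phi (nrm H) v w ^+ 2 *+ (2 * p))}.
Proof.
move=> HA; have [r [rW rH nr]] := exists_reflection HA.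
have [unit_e _] := nrmP HA; set e := nrm H in unit_e *.
have [k nk [p pp hp]] := group_prime_order rW (elimN eqP nr).
set s := iter k r in nk hp.
have sW : s \in W by apply: iter_group.
have fix_iter i f : fixes_perp phi f e -> fixes_perp phi (iter i f) e.
  by move=> fe v ve; elim: i => //= i ->; apply: fe.
have se : fixes_perp phi s e by apply: fix_iter; exact/fixesP.
have iterW i := iter_group i sW.
have iter_e i := fix_iter i s se.
pose z := eigval phi e s.
have eig_iter i : eigval phi e (iter i s) = z ^+ i.
  elim: i => [|i IH]; first exact: unit_e.
  by rewrite exprS -IH -eigval_comp //; apply: W_unitary.
have zp : z ^+ p = 1 by rewrite -eig_iter hp.
have z1 : 1 - z != 0.
  rewrite subr_eq0 eq_sym; apply/eqP => z1; apply: nk.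
  by apply: (eigval_eq1 hphi phi_pos unit_e) => //; apply: W_unitary.
have sumz : \sum_(i < p) z ^+ i = 0.
  have : (1 - z) * \sum_(i < p) z ^+ i = 0 by rewrite -opprB mulNr -subrX1 zp subrr oppr0.
  by move=> /(congr1 (fun x => (1 - z)^-1 * x)); rewrite mulrA mulVr ?mul1r ?mulr0.
exists p => // v w vO wO.
have -> : axis_form phi e v w ^+ 2 *+ (2 * p) = \sum_(i < p)
    (jpart (phi (v - iter i s v) v) * jpart (phi (w - iter i s w) w)
     - jpart (phi (v - iter i s v) w) * jpart (phi (w - iter i s w) v)).
  under eq_bigr => i _ do
    rewrite (axis_form_minor hphi phi_pos unit_e _ _ (W_unitary (iterW i))
      (iter_e i)) eig_iter.
  rewrite -mulr_suml -(raddf_sum (real_complex R)) sumrB -mulr_sumr -qre_sum sumz.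
  by rewrite /= mulr0 subr0 sumr_const card_ord -mulrnA rmorphMn /= mulr_natl.
by apply: zspan_sum => i _; apply: zspanB; apply: zspan_prods; apply: zspan_jform_sub.
Qed.

(* [P] collects the odd primes coming from [axis_form_integral], so that
   [2 sqrt(P) axis_form] is a square root of an element of the span. *)
Lemma hyperplane_sum_integral : exists P : nat, exists2 a : R,
    [/\ (0 < P)%N, forall p, prime p -> (logn p P <= 1)%N &
        integralOver (intr : int -> R[i]) (2 * Num.sqrt P%:R * a)%:C%C] &
    a *+ dim V = #|` hyperplanes W|%:R.
Proof.
have [pr prP] : exists pr : set V -> nat, forall H, H \in hyperplanes W ->
    prime (pr H) /\ {in orbit_vectors &, forall v w,
    zspan (prods orbit_values orbit_values)
      (axis_form phi (nrm H) v w ^+ 2 *+ (2 * pr H))}.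
  suff /boolp.choice[pr ?] : forall H, exists p, H \in hyperplanes W ->
      prime p /\ {in orbit_vectors &, forall v w,
      zspan (prods orbit_values orbit_values)
        (axis_form phi (nrm H) v w ^+ 2 *+ (2 * p))} by exists pr.
  move=> H; have [/axis_form_integral[p pp hp]|nH] := boolP (H \in hyperplanes W).
    by exists p.
  by exists 0%N.
(* Each odd prime occurs once, so [P] is squarefree; the prime 2 already divides [2 * P]. *)
pose s := undup [seq p <- [seq pr H | H <- hyperplanes W] | p != 2].
pose P := (\prod_(p <- s) p)%N.
have ps : all prime s.
  by apply/allP => p; rewrite mem_undup mem_filter => /andP[_ /mapP[H /prP[? _] ->]].
have P0 : (0 < P)%N by rewrite /P big_seq prodn_cond_gt0 // => p /(allP ps)/prime_gt0.
have prdvd H : H \in hyperplanes W -> (pr H %| 2 * P)%N.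
  move=> HA; have [->|n2] := eqVneq (pr H) 2%N; first exact: dvdn_mulr.
  apply/dvdn_mull; rewrite /P (big_rem (pr H)) ?dvdn_mulr //.
  by rewrite mem_undup mem_filter n2 map_f.
(* This weight gives every projection coefficient one, so the trace counts hyperplanes. *)
have [f g h fW hW fh|a [ha aV]] := @reflection_sum_scalar (fun H => (mult H)%:R^-1).
  by rewrite mult_conj.
have cm H : H \in hyperplanes W -> (mult H)%:R^-1 * (mult H)%:R = 1 :> R.
  by move=> HA; rewrite mulVf // pnatr_eq0 multE.
exists P, a; last first.
  by rewrite aV big_seq (eq_bigr _ cm) -big_seq -sum1_size natr_sum.
split=> //; first by move=> p pp; apply: logn_prod_primes => //; apply: undup_uniq.
pose c := (2 * Num.sqrt P%:R : R)%:C%C.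
pose ts := [seq c * axis_form phi (nrm H) vw.1 vw.2 |
  H <- hyperplanes W, vw <- [seq (v, w) | v <- orbit_vectors, w <- orbit_vectors]].
apply: (@integral_sum_roots _ orbit_values ts); first exact: orbit_values_neq0.
  move=> _ /allpairsP[[H _] /= [HA /allpairsP[[v w] /= [vO wO ->]] ->]] /=.
  (* Here [c ^+ 2 = 4 P = (2 p) (2 P / p)] with [p = pr H], and the last factor is a natural number
     by [prdvd]. *)
  have -> : (c * axis_form phi (nrm H) v w) ^+ 2 =
      axis_form phi (nrm H) v w ^+ 2 *+ (2 * pr H) *+ (2 * P %/ pr H).
    rewrite -mulrnA -mulnA [(pr H * _)%N]mulnC divnK ?prdvd // exprMn.
    rewrite -mulr_natl; congr (_ * _); rewrite -rmorphXn /= exprMn sqr_sqrtr ?ler0n //.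
    by rewrite mulnA natrM rmorphM /= rmorphXn /= !rmorph_nat -natrX.
  by apply: zspanMn; have [_] := prP _ HA; apply.
move=> _ /allpairsP[[v w] /= [vO wO ->]].
(* The scalar times [jpart (phi v w)] becomes the sum over [H] of the members [c * axis_form] of
   [ts]. *)
rewrite rmorphM /= -/c -mulrA -jformZ -ha form_suml // jpart_sum mulr_sumr.
rewrite big_seq; apply: zspan_sum => H HA; apply: mem_zspan.
rewrite cm // realq1 mul1r formZl //.
apply/allpairsP; exists (H, (v, w)); split=> //=.
by apply/allpairsP; exists (v, w).
Qed.

End ReflectionGroup.

(** * Rationality of the scalars and conclusion *)

Lemma ratr_of_mulrn (R : realType) (a : R) (m n : nat) : (0 < n)%N ->
  a *+ n = m%:R -> a%:C%C = ratr (m%:R / n%:R) :> R[i].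
Proof.
move=> n0 an; have -> : a = ratr (m%:R / n%:R).
  by rewrite fmorph_div !rmorph_nat -an -[a *+ n]mulr_natr mulfK // pnatr_eq0 -lt0n.
exact: (fmorph_rat (real_complex R)).
Qed.

Theorem theorem4p1 (R : realType) (V : vectType (quat R)^c) (n : nat)
    (hn : dim V = n) (phi : V -> V -> quat R)
    (hphi : hermitian_form phi) (phi_pos : positive_definite phi)
    (W : {fset (V -> V)}) (W_group : transformation_group W)
    (W_unitary : forall f, f \in W -> unitary phi f)
    (W_irr : irreducible_action W) :
  let N := #|` reflections W| in
  let Nstar := #|` hyperplanes W| in
  let g : rat := (2 * N)%:R / n%:R in
  let h : rat := (N + Nstar)%:R / n%:R in
  let k : rat := (2 * Nstar)%:R / n%:R in
  [/\ g \is a Num.int, h \is a Num.int & k \is a Num.int].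
Proof.
move=> N Nstar g h k.
have [nrm nrmP] := hyperplane_normals hphi phi_pos W_unitary.
have [u unit_u] := exists_unit_vector hphi phi_pos W_irr.
(* A zero-dimensional space has no unit vector. *)
have n0 : (0 < n)%N.
  rewrite lt0n -hn; apply/eqP => V0.
  have u0 : u = 0.
    by rewrite (basisq_sum u) big1 // => i; have := ltn_ord i; rewrite [X in (_ < X)%N]V0.
  by move: unit_u; rewrite u0 (form0l hphi) => /eqP; rewrite eq_sym oner_eq0.
have [a a_int] :=
  reflection_sum_integral hphi phi_pos W_group W_unitary nrmP W_irr unit_u.
rewrite hn => /(ratr_of_mulrn n0) aE.
have [P [b [P0 sqP b_int]]] :=
  hyperplane_sum_integral hphi phi_pos W_group W_unitary nrmP W_irr unit_u.
rewrite hn => /(ratr_of_mulrn n0) bE.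
have h_int : h \is a Num.int by apply: (@integral_ratr_int R[i]); rewrite -aE.
have k_int : k \is a Num.int.
  (* [P k^2] is the square of the integral element [2 sqrt(P) b], because [b = Nstar / n]. *)
  apply: (int_of_squarefree_mul_sqr P0 sqP); apply: (@integral_ratr_int R[i]).
  have -> : P%:R * k ^+ 2 = (2 ^+ 2 * P%:R) * (Nstar%:R / n%:R) ^+ 2.
    by rewrite /k natrM; ring.
  rewrite rmorphM rmorphXn /= -bE -rmorphXn rmorphM rmorphXn /= !rmorph_nat.
  have := integral_mul b_int b_int.
  rewrite -expr2 -rmorphXn /= !exprMn sqr_sqrtr ?ler0n //.
  rewrite 2!(rmorphM (real_complex R)) 2!(rmorphXn (real_complex R)) !rmorph_nat.
  by rewrite (rmorphXn ratr) rmorph_nat.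
split=> //; have -> : g = 2 * h - k by rewrite /g /h /k !natrM natrD; ring.
by apply: rpredB => //; apply: rpredM => //; apply: rpred_nat.
Qed.
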